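(* $\mathrm{S}^{=}$ is not closed under concatenation.
   Context: Let $\Gamma=\Sigma\cup\{¢,\$\}$, where ¢ and \$ are left and right end-markers. A PFA $\mathcal{P}=(S,\Sigma,\{\mathsf{A}_\sigma:\sigma\in\Gamma\},F)$ has states $S=\{s_1,\dots,s_n\}$ (start state $s_1$), real stochastic $n\times n$ transition matrices $\mathsf{A}_\sigma$, and accepting states $F$; its acceptance probability on $w\in\Sigma^*$ is $f_{\mathcal{P}}(w)=\sum_{s_i\in F}\mathsf{v}(i)$, where $\mathsf{v}=(1,0,\dots,0)\mathsf{A}_{¢}\mathsf{A}_{w_1}\cdots\mathsf{A}_{w_{|w|}}\mathsf{A}_{\$}$. $\mathrm{S}^{=}$ is the class of languages of the form $\{w: f_{\mathcal{P}}(w)=\lambda\}$ for some PFA $\mathcal{P}$ and $\lambda\in[0,1]$. *)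

(* Defs.v *)
From HB Require Import structures.
From mathcomp Require Import all_boot all_order all_algebra.
From mathcomp Require Import classical_sets reals.

Set Implicit Arguments.
Unset Strict Implicit.
Unset Printing Implicit Defensive.

Import Order.TTheory GRing.Theory Num.Theory.

Local Open Scope classical_set_scope.
Local Open Scope ring_scope.

(* Tape alphabet: the input alphabet with fresh left (cent) and right (dollar)
   end-markers. *)
Inductive tape_symbol (Sigma : Type) : Type :=
  | LeftMarker
  | RightMarker
  | Letter of Sigma.

Arguments LeftMarker {Sigma}.
Arguments RightMarker {Sigma}.

(* Row-stochastic: distributions are row vectors, acted on from the right. *)
Definition stochastic (R : realType) (n : nat) (A : 'M[R]_n) : Prop :=
  (forall i j, 0 <= A i j) /\ (forall i, \sum_j A i j = 1).

(* The state set is 'I_(pfa_size.+1), so it is nonempty; the start state is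
   ord0. *)
Record pfa (R : realType) (Sigma : finType) : Type := Pfa {
  pfa_size : nat;
  pfa_trans : tape_symbol Sigma -> 'M[R]_(pfa_size.+1);
  pfa_stochastic : forall c, stochastic (pfa_trans c);
  pfa_accept : {set 'I_(pfa_size.+1)}
}.

Definition final_distr (R : realType) (Sigma : finType) (P : pfa R Sigma)
    (w : seq Sigma) : 'rV[R]_(pfa_size P).+1 :=
  delta_mx 0 ord0 *m pfa_trans P LeftMarker
    *m (\prod_(a <- w) pfa_trans P (Letter a))
    *m pfa_trans P RightMarker.

Definition accept_prob (R : realType) (Sigma : finType) (P : pfa R Sigma)
    (w : seq Sigma) : R :=
  \sum_(i in pfa_accept P) final_distr P w 0 i.

Definition language (Sigma : finType) : Type := set (seq Sigma).

Definition S_eq (R : realType) (Sigma : finType) (L : language Sigma) : Prop :=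
  exists (P : pfa R Sigma) (lambda : R),
    0 <= lambda <= 1 /\ L = [set w | accept_prob P w = lambda].

Definition concat (Sigma : finType) (L1 L2 : language Sigma) :
    language Sigma :=
  [set u ++ v | u in L1 & v in L2].

Definition closed_under_concat
    (C : forall Sigma : finType, language Sigma -> Prop) : Prop :=
  forall (Sigma : finType) (L1 L2 : language Sigma),
    C Sigma L1 -> C Sigma L2 -> C Sigma (concat L1 L2).

(* Main.v *)
Require Import Defs.
From mathcomp Require Import all_boot all_order all_algebra.
From mathcomp Require Import classical_sets reals.
From mathcomp Require Import lra zify.

(** Over {a, b}, encoded as {true, false}, let L be the set of words w with
    #a(w) = #b(w) + 1.  A PFA
    can compute 1/2 + 2^-#a(w) / 2 - 2^-#b(w) / 4, so L is in S^=, and so is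
    the set of all words.  Their concatenation contains b^j a^k iff j < k.
    If it were {w | f(w) = lambda} for an n-state PFA, then for fixed k the
    sequence j |-> f(b^j a^k) - lambda would satisfy the linear recurrence
    whose characteristic polynomial is (X - 1) times that of the matrix of b;
    with k = n + 1, its vanishing for j <= n would force it to vanish at
    j = n + 1, although b^k a^k is not in the concatenation. *)

Set Implicit Arguments.
Unset Strict Implicit.
Unset Printing Implicit Defensive.

Import Order.TTheory GRing.Theory Num.Theory.

Local Open Scope classical_set_scope.
Local Open Scope ring_scope.

Definition unary_diff : language bool :=
  [set w | count_mem true w = (count_mem false w).+1].

(** A prefix lying in [unary_diff] has at least one [true], so it runs past the whole block of
    [false]; it then holds j letters [false] and needs j + 1 of the k letters [true]. *)
Lemma nseq_concat_unary_diff (j k : nat) :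
  concat unary_diff setT (nseq j false ++ nseq k true) <-> (j < k)%N.
Proof.
split=> [[u uL [v _ uv]]|jk].
- rewrite /unary_diff /= in uL.
  have ctrue : (count_mem true u <= k)%N.
    have /= := congr1 (count_mem true) uv.
    by rewrite !count_cat !count_nseq /=; lia.
  (* A prefix of length at most j would consist of [false] only, contradicting [uL]. *)
  have [uj|ju] := leqP (size u) j.
    have /(congr1 (count_mem true)) : u = take (size u) (nseq j false).
      by rewrite -[LHS](take_size_cat v erefl) uv takel_cat ?size_nseq.
    by rewrite take_nseq // count_nseq uL.
  have : (count_mem false (nseq j false) <= count_mem false u)%N.
    rewrite -[nseq j false](take_size_cat (nseq k true) (size_nseq j false)).
    rewrite -uv takel_cat ?(ltnW ju) //.
    by rewrite -[X in (_ <= count _ X)%N](cat_take_drop j) count_cat leq_addr.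
  by rewrite count_nseq mul1n => /leq_ltn_trans; apply; rewrite -uL.
- exists (nseq j false ++ nseq j.+1 true).
    rewrite /unary_diff /= !count_cat /= !count_nseq.
    by rewrite !mul1n !mul0n !addn0 add0n.
  exists (nseq (k - j.+1) true) => //.
  by rewrite -catA -nseqD subnKC.
Qed.

Definition mx4 (R : realType) (s : seq (seq R)) : 'M[R]_4 :=
  \matrix_(i, j) nth 0 (nth [::] s i) j.

(* States 0 and 1 hold the masses 2^-#a / 2 and 2^-#b / 4; the mass they lose
   goes to the rejecting sink 3 and to the accepting sink 2 respectively. *)
Definition unary_diff_mx (R : realType) (c : tape_symbol bool) : 'M[R]_4 :=
  match c with
  | LeftMarker => mx4 [:: [:: 1/2; 1/4; 1/4; 0]; [:: 0; 1; 0; 0];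
                          [:: 0; 0; 1; 0]; [:: 0; 0; 0; 1]]
  | RightMarker => 1%:M
  | Letter true => mx4 [:: [:: 1/2; 0; 0; 1/2]; [:: 0; 1; 0; 0];
                           [:: 0; 0; 1; 0]; [:: 0; 0; 0; 1]]
  | Letter false => mx4 [:: [:: 1; 0; 0; 0]; [:: 0; 1/2; 1/2; 0];
                            [:: 0; 0; 1; 0]; [:: 0; 0; 0; 1]]
  end.

Lemma stochastic1 (R : realType) (n : nat) : stochastic (1%:M : 'M[R]_n).
Proof.
split=> i => [j|]; first by rewrite mxE ler0n.
rewrite (bigD1 i) //= mxE eqxx big1 ?addr0 // => j ji.
by rewrite mxE eq_sym (negPf ji).
Qed.

Lemma unary_diff_mx_stochastic (R : realType) (c : tape_symbol bool) :
  stochastic (unary_diff_mx R c).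
Proof.
case: c => [||[]].
all: try exact: stochastic1.
all: split=> [i j|i]; rewrite ?mxE ?big_ord_recl ?big_ord0 ?mxE.
all: case: i => [[|[|[|[|i]]]] hi] //=; try lra.
all: case: j => [[|[|[|[|j]]]] hj] //=; lra.
Qed.

Definition unary_diff_pfa (R : realType) : pfa R bool :=
  Pfa (@unary_diff_mx_stochastic R)
    [set i : 'I_4 | (i == 0%N :> nat) || (i == 2%N :> nat)]%SET.

(** Here x and y stand for 2^-#a and 2^-#b. Leaving them free gives a family stable under both
    letters, as the induction on the word requires. *)
Definition unary_diff_distr (R : realType) (x y : R) : 'rV[R]_4 :=
  \row_j nth 0 [:: x / 2; y / 4; 1/2 - y / 4; 1/2 - x / 2] j.

Lemma unary_diff_distr_word (R : realType) (w : seq bool) (x y : R) :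
  unary_diff_distr x y *m \prod_(a <- w) unary_diff_mx R (Letter a) =
  unary_diff_distr (x / 2 ^+ count_mem true w) (y / 2 ^+ count_mem false w).
Proof.
elim: w x y => [|a w IH] x y; first by rewrite big_nil mulmx1 !divr1.
rewrite big_cons mulmxA.
have -> : unary_diff_distr x y *m unary_diff_mx R (Letter a) =
          if a then unary_diff_distr (x / 2) y else unary_diff_distr x (y / 2).
  apply/rowP=> j; rewrite mxE !big_ord_recl big_ord0 /=.
  by case: a => /=; rewrite !mxE /=;
     case: j => [[|[|[|[|j]]]] hj] //=; lra.
by case: a; rewrite IH /= add0n add1n exprS invfM mulrA.
Qed.

Lemma unary_diff_accept_prob (R : realType) (w : seq bool) :
  accept_prob (unary_diff_pfa R) w =
  1/2 + (2 ^+ count_mem true w)^-1 / 2 - (2 ^+ count_mem false w)^-1 / 4.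
Proof.
rewrite /accept_prob /final_distr /= mulmx1.
have -> : delta_mx 0 ord0 *m unary_diff_mx R LeftMarker =
          unary_diff_distr 1 1.
  rewrite -rowE; apply/rowP=> j; rewrite !mxE /=.
  by case: j => [[|[|[|[|j]]]] hj] //=; lra.
rewrite unary_diff_distr_word big_mkcond /= !big_ord_recl big_ord0 !inE /=.
by rewrite !mxE /=; lra.
Qed.

(** At cutpoint 1/2 the two dyadic terms must cancel, that is, 2^#a = 2^(#b + 1); powers of 2 are
    injective in the exponent. *)
Lemma S_eq_unary_diff (R : realType) : S_eq R unary_diff.
Proof.
exists (unary_diff_pfa R), (1/2); split; first by lra.
apply/seteqP; split=> w /=; rewrite unary_diff_accept_prob /unary_diff /=.
  by move=> ->; rewrite exprS invfM; lra.
move=> e.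
have {e} : (2 ^+ count_mem true w)^-1 = (2 ^+ (count_mem false w).+1)^-1 :> R.
  by rewrite [in RHS]exprS invfM; lra.
by move/invr_inj/ieexprIn; apply; rewrite ?ltr0n // pnatr_eq1.
Qed.

Lemma S_eq_setT (R : realType) (Sigma : finType) :
  S_eq R ([set: seq Sigma] : language Sigma).
Proof.
pose P := @Pfa R Sigma 0 (fun=> 1%:M) (fun=> stochastic1 R 1) [set: 'I_1]%SET.
exists P, 1; split; first by rewrite ler01 lexx.
apply/seteqP; split=> // w _ /=.
rewrite /accept_prob /final_distr /= !mulmx1.
have -> : \prod_(a <- w) 1%:M = 1 :> 'M[R]_1 by apply: big1.
rewrite mulmx1 (bigD1 ord0) ?inE //= mxE !eqxx big1 ?addr0 // => i.
by rewrite !ord1 andbC eqxx.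
Qed.

(** With [v] fixed, acceptance is a linear functional [phi] of the power [B ^+ j], so the sum is
    [phi] applied to q(B). *)
Lemma sum_recurrence (R : realType) (Sigma : finType) (P : pfa R Sigma)
    (b : Sigma) (v : seq Sigma) (q : {poly R}) :
  horner_mx (pfa_trans P (Letter b)) q = 0 ->
  \sum_(j < size q) q`_j * accept_prob P (nseq j b ++ v) = 0.
Proof.
move=> q0.
pose B := pfa_trans P (Letter b).
pose C := \prod_(a <- v) pfa_trans P (Letter a).
pose phi (M : 'M[R]_((pfa_size P).+1)) := \sum_(i in pfa_accept P)
  (delta_mx (0 : 'I_1) ord0 *m pfa_trans P LeftMarker *m (M *m C)
     *m pfa_trans P RightMarker) 0 i.
have phiE j : accept_prob P (nseq j b ++ v) = phi (B ^+ j).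
  by rewrite /accept_prob /final_distr big_cat /= big_nseq -Monoid.iteropE.
have -> : \sum_(j < size q) q`_j * accept_prob P (nseq j b ++ v) =
          phi (horner_mx B q).
  rewrite -[in RHS](coefK q) poly_def rmorph_sum /phi /=.
  under eq_bigr => j _ do rewrite phiE /phi mulr_sumr.
  rewrite exchange_big /=; apply: eq_bigr => i _.
  rewrite mulmx_suml mulmx_sumr mulmx_suml summxE; apply: eq_bigr => j _.
  rewrite linearZ /= rmorphXn /= horner_mx_X.
  by rewrite -scalemxAl -scalemxAr -scalemxAl [RHS]mxE.
by rewrite q0 /phi mul0mx mulmx0 mul0mx; apply: big1 => i _; rewrite mxE.
Qed.

Theorem theorem5p2 (R : realType) : ~ closed_under_concat (@S_eq R).
Proof.
move=> /(_ _ _ _ (S_eq_unary_diff R) (S_eq_setT R _))[P [lambda [_ LE]]].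
have inL j k : accept_prob P (nseq j false ++ nseq k true) = lambda <->
               (j < k)%N.
  by rewrite -nseq_concat_unary_diff LE.
pose B := pfa_trans P (Letter false).
(* The second factor makes q annihilate [B] by Cayley-Hamilton; the first makes the coefficients of
   q sum to 0, so that constant sequences obey the recurrence too. *)
pose q := ('X - 1%:P) * char_poly B.
have qmonic : q \is monic by rewrite monicMl ?monicXsubC ?char_poly_monic.
(* With k the degree of q, the recurrence involves exactly j = 0, ..., k, and only j = k falls
   outside the concatenation. *)
pose k := (size q).-1.
have sq : size q = k.+1 by rewrite prednK // size_poly_gt0 monic_neq0.
have qB : horner_mx B q = 0.
  by rewrite rmorphM /= Cayley_Hamilton mulr0.
have q1 : \sum_(j < k.+1) q`_j = 0.
  transitivity q.[1]; last by rewrite hornerM hornerXsubC subrr mul0r.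
  by rewrite horner_coef sq; apply: eq_bigr => j _; rewrite expr1n mulr1.
have := sum_recurrence (nseq k true) qB.
rewrite sq big_ord_recr /=.
under eq_bigr => j _ do rewrite (inL j k).2 //.
have qk : q`_k = 1 by rewrite -[RHS](monicP qmonic).
(* Since q is monic, its lower coefficients sum to -1, which forces the value at j = k to be
   [lambda] as well. *)
move: q1; rewrite -mulr_suml big_ord_recr /= qk mul1r => /eqP.
rewrite addr_eq0 => /eqP ->; rewrite mulN1r addrC => /eqP.
by rewrite subr_eq0 => /eqP /inL; rewrite ltnn.
Qed.
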